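(* Let $P$ be a directed set equipped with a second-countable topology in which every convergent sequence is bounded. Let $\mathcal{F}$ be a free filter on a countable set $X$. Suppose there is a family $\{K_p:p\in P\}$ of compact subsets of $\mathcal{F}$ (where $\mathcal{F}\subseteq\mathcal{P}(X)$ carries the subspace topology) such that $\mathcal{F}=\bigcup_{p\in P}K_p$, $K_p\subseteq K_q$ whenever $p\leq q$ in $P$, and the set $\bigcap K_p\subseteq X$ is infinite for each $p\in P$. Then $\mathcal{F}$ is a meager subset of $\mathcal{P}(X)$.
   Context: All topological spaces are assumed to be Tychonoff. A poset is directed if any two elements have a common upper bound. A subset of $P$ is bounded if it has an upper bound in $P$; ''every convergent sequence is bounded'' means that whenever a sequence in $P$ converges in the given topology, the set of its terms has an upper bound in $P$. A filter on a set $X$ is a collection of non-empty subsets of $X$ closed under finite intersections and under taking supersets in $X$; it is free if the intersection of all its members is empty. The power set $\mathcal{P}(X)$ is identified with $2^X$ (via characteristic functions) and given the product topology. $\bigcap K_p$ denotes the intersection of all members (subsets of $X$) of the collection $K_p$. *)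

(* Defs.v *)
From HB Require Import structures.
From mathcomp Require Import all_boot all_order all_algebra.
From mathcomp Require Import all_classical all_reals all_analysis.

Set Implicit Arguments.
Unset Strict Implicit.
Unset Printing Implicit Defensive.

Local Open Scope classical_set_scope.

Definition charfun {X : Type} (A : set X) : {ptws X -> bool} :=
  fun x => x \in A.

(* [set X] with the topology of 2^X: since [charfun] is a bijection onto the
   product of X copies of the discrete space bool, the initial topology it
   induces is the one transported from that product. *)
Definition power_space (X : Type) : Type := initial_topology (@charfun X).

HB.instance Definition _ (X : Type) := Topological.on (power_space X).

(* [completely_regular_space] does not include any separation axiom. *)
Definition tychonoff_space (T : topologicalType) : Prop :=
  accessible_space T /\ completely_regular_space T.

Definition nowhere_dense {T : topologicalType} (A : set T) : Prop :=
  interior (closure A) = set0.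

Definition meager {T : topologicalType} (A : set T) : Prop :=
  exists2 N : (set T)^nat,
    (forall n, nowhere_dense (N n)) & A = \bigcup_n N n.

Definition directed {d : Order.disp_t} (P : porderType d) : Prop :=
  forall p q : P, exists r : P, (p <= r)%O /\ (q <= r)%O.

(* [POrderedTopological] carries an order and a topology with no
   compatibility between them. *)
Definition convergent_seqs_bounded {d : Order.disp_t}
    (P : POrderedTopological.type d) : Prop :=
  forall (u : nat -> P) (l : P), u @ \oo --> l -> has_ubound (range u).

Definition free_filter {X : Type} (F : set_system X) : Prop :=
  ProperFilter F /\ \bigcap_(A in F) A = set0.

(* Main.v *)
(** By second countability it suffices to find, for every point p, a basic open
   set U containing p such that the union of the K q for q in U is nowhere dense.
   A set S of subsets of nat that is not nowhere dense admits an N such that for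
   every M some member of S avoids [N, M). If every basic neighbourhood V_n of p
   gave such an N_n, then (after making N_n strictly increasing) one could pick
   q_n in V_n and B_n in K q_n avoiding [N_n, N_(n+1)). As q_n converges to p,
   the q_n are bounded by some r, so every B_n lies in K r and the intersection
   of K r avoids [N_0, oo), i.e. is finite. *)
Require Import Defs.
From mathcomp Require Import all_boot all_order all_algebra.
From mathcomp Require Import all_classical all_reals all_analysis.
Local Open Scope classical_set_scope.

(** Injectivity of [f] means that at most one new coordinate is fixed as [n] grows by one, so the
    cylinder is a finite intersection of the subbasic neighbourhoods [coord x]. *)
Lemma nbhs_cylinder (X : Type) (f : X -> nat) (A : set X) (n : nat) :
  {in [set: X] &, injective f} ->
  nbhs (A : power_space X) [set C | forall x, (f x < n)%N -> C x <-> A x].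
Proof.
move=> finj.
have coord x : nbhs (A : power_space X)
    [set C : power_space X | (C : set X) x <-> A x].
  have nA : nbhs (charfun A) [set g | g x = (x \in A)].
    (* Evaluation at [x] is continuous: the identity convergence is projected to one factor of the
       product. *)
    have /cvg_sup/(_ x) cvgx : nbhs (charfun A) --> charfun A by exact: cvg_id.
    apply: (cvgx [set g | g x = (x \in A)]).
    exists [set g | g x = (x \in A)] => //; split => //.
    by exists [set x \in A] => //; exact: discrete_open.
  have nC : nbhs (A : power_space X)
      (@charfun X @^-1` [set g | g x = (x \in A)]).
    exact: (@initial_continuous _ _ (@charfun X) A _ nA).
  apply: filterS nC => C /= CA.
  have {}CA : (x \in (C : set X)) = (x \in A) by [].
  by split => /mem_set xC; apply/set_mem; [rewrite -CA|rewrite CA].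
elim: n => [|n IHn]; first exact: filterE.
have [[x fx]|nx] := pselect (exists x, f x = n).
  apply: filterS (filterI IHn (coord x)) => C [CA Cx] y.
  rewrite ltnS leq_eqVlt => /orP[/eqP fy|/CA//].
  by rewrite (finj y x) ?inE// fx.
apply: filterS IHn => C CA y.
rewrite ltnS leq_eqVlt => /orP[/eqP fy|/CA//].
by exfalso; apply: nx; exists y.
Qed.

(** Otherwise each [n] yields some [C n] outside [U] agreeing with [A] where [f x < n]; these
    converge to [A] coordinatewise, hence eventually enter [U]. *)
Lemma nbhs_sub_cylinder (X : Type) (f : X -> nat) (A : power_space X)
    (U : set (power_space X)) :
  nbhs A U ->
  exists n, forall C : set X, (forall x, (f x < n)%N -> C x <-> A x) -> U C.
Proof.
move=> [_ [[W oW <-] /= WA sub]].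
apply: contrapT => /forallNP H.
have {}H n : exists C : set X, (forall x, (f x < n)%N -> C x <-> A x) /\ ~ U C.
  by have /existsNP[C /not_implyP] := H n; exists C.
have [C CP] := choice H.
have : (fun n => charfun (C n)) @ \oo --> charfun A.
  apply/cvg_sup => x V [_ [[V0 oV0 <-] /= V0x] V0V].
  exists (f x).+1 => // n /= fxn; apply: V0V => /=.
  suff -> : charfun (C n) x = charfun A x by [].
  by apply/idP/idP => /set_mem h; apply/mem_set; move: h; apply CP.
move=> /(_ W).
have /[swap]/[apply] : nbhs (charfun A) W by apply: open_nbhs_nbhs.
by move=> [m _ /(_ m (leqnn m))] /sub; have [] := CP m.
Qed.

Lemma not_nowhere_dense_gap (X : Type) (f : X -> nat)
    (S : set (power_space X)) :
  {in [set: X] &, injective f} -> ~ nowhere_dense S ->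
  exists N, forall M, exists2 B : set X, S B &
    forall x, (N <= f x < M)%N -> ~ B x.
Proof.
move=> finj /eqP/set0P[A intA].
have [N AN] := @nbhs_sub_cylinder _ f _ _ intA.
exists N => M.
(* Cutting [A] off at [N] stays in the cylinder, hence in the closure of [S]; a member of [S]
   agreeing with [C] below [M] then avoids [[N, M)]. *)
pose C : set X := [set x | A x /\ (f x < N)%N].
have clC : closure S (C : power_space X).
  by apply: AN => x xN; split=> [[]|Ax].
have [B [SB BC]] := clC _ (@nbhs_cylinder _ f C M finj).
exists B => // x /andP[Nx xM] /(BC x xM)[_].
by rewrite ltnNge Nx.
Qed.

Lemma countable_basis_seq (T : topologicalType) (B : set (set T)) (p : T) :
  countable B -> basis B ->
  exists2 V : nat -> set T, (forall n, B (V n) /\ V n p) &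
    forall q : nat -> T, (forall n, V n (q n)) -> q @ \oo --> p.
Proof.
move=> /countable_injP[g ginj] [Bop Bp].
(* The intersection of the finitely many basic neighbourhoods of [p] with code below [n]. It
   decreases with [n], so choosing [V n] inside [W n] gives convergence even if [V] itself is not
   decreasing. *)
pose W n := [set x | forall U, B U -> U p -> (g U < n)%N -> U x].
have nbhsW n : nbhs p (W n).
  elim: n => [|n IHn]; first exact: filterE.
  have [[U [BU Up gU]]|noU] := pselect (exists U, [/\ B U, U p & g U = n]).
    have nU : nbhs p U by apply: open_nbhs_nbhs; split => //; exact: Bop.
    apply: filterS (filterI IHn nU) => x [Wx Ux] U' BU' U'p.
    rewrite ltnS leq_eqVlt => /orP[/eqP gU'|]; last exact: Wx.
    by rewrite (ginj U' U) ?inE// gU'.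
  apply: filterS IHn => x Wx U BU Up.
  rewrite ltnS leq_eqVlt => /orP[/eqP gU|]; last exact: Wx.
  by exfalso; apply: noU; exists U.
have subW n : exists V, [/\ B V, V p & V `<=` W n].
  by have [V [BV Vp] VW] := Bp p _ (nbhsW n); exists V.
have [V VP] := choice subW.
exists V => [n|q Vq A /Bp[U [BU Up] UA]]; first by have [] := VP n.
exists (g U).+1 => // n /= gUn; apply: UA.
by have [_ _ /(_ _ (Vq n))] := VP n; exact.
Qed.

Lemma meager_countable_bigcup (T : topologicalType) (I : Type) (D : set I)
    (S : I -> set T) :
  countable D -> (forall i, D i -> nowhere_dense (S i)) ->
  meager (\bigcup_(i in D) S i).
Proof.
move=> /countable_injP[g ginj] Snd.
(* Each fibre of [g] on [D] has at most one index, so every term is some [S i] or empty. *)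
exists (fun n => \bigcup_(i in D `&` g @^-1` [set n]) S i) => [n|].
  have [[i [Di gi]]|no] := pselect (exists i, D i /\ g i = n).
    suff -> : D `&` g @^-1` [set n] = [set i] by rewrite bigcup_set1; exact: Snd.
    apply/seteqP; split => [j [Dj gj]|_ ->//].
    by apply: ginj; rewrite ?inE// gi.
  suff -> : D `&` g @^-1` [set n] = set0.
    by rewrite /nowhere_dense bigcup_set0 closure0 interior0.
  by apply/seteqP; split => // i [Di gi]; apply: no; exists i.
apply/seteqP; split => [x [i Di Six]|x [n _ [i [Di _] Six]]]; last by exists i.
by exists (g i) => //; exists i.
Qed.

Lemma nowhere_dense_basic_union (d : Order.disp_t)
    (P : POrderedTopological.type d) (B : set (set P)) (X : Type)
    (K : P -> set (power_space X)) (p : P) :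
  countable B -> basis B -> convergent_seqs_bounded P ->
  countable [set: X] ->
  (forall p q : P, (p <= q)%O -> K p `<=` K q) ->
  (forall p : P, infinite_set (\bigcap_(A in K p) (A : set X))) ->
  exists2 U, B U /\ U p & nowhere_dense (\bigcup_(q in U) K q).
Proof.
move=> Bcount Bbasis Pseq /countable_injP[f finj] Kmono Kinf.
apply: contrapT => noU.
have [V VB Vcvg] := @countable_basis_seq _ _ p Bcount Bbasis.
have gap n : exists N, forall M, exists2 A : set X,
    (\bigcup_(q in V n) K q) A & forall x, (N <= f x < M)%N -> ~ A x.
  by apply: not_nowhere_dense_gap => // nd; apply: noU; exists (V n).
have {gap}[N0 N0P] := choice gap.
(* The sum gives [N0 n <= N n], so gaps starting at [N n] are still available; the summand [n] makes
   [N] unbounded. *)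
pose N n := (n + \sum_(i < n.+1) N0 i)%N.
have leN n : (N0 n <= N n)%N by rewrite /N big_ord_recr/= addnA leq_addl.
have geN n : (n <= N n)%N by rewrite leq_addr.
have qA n : exists qA : P * set X, [/\ V n qA.1, K qA.1 qA.2 &
    forall x, (N n <= f x < N n.+1)%N -> ~ qA.2 x].
  have [A [q Vq KqA] avoid] := N0P n (N n.+1).
  exists (q, A); split => //= x /andP[Nx xN].
  by apply: avoid; rewrite xN andbT (leq_trans (leN n)).
have {qA}[qA qAP] := choice qA.
have [r rub] : has_ubound (range (fun n => (qA n).1)).
  by apply: Pseq (Vcvg _ _) => n; have [] := qAP n.
apply: (Kinf r); apply: (@sub_finite_set _ _ (f @^-1` `I_(N 0%N))).
  move=> x Ix /=; rewrite ltnNge; apply/negP => N0x.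
  (* A point [x] common to all members of [K r] lies in every [(qA n).2], so [f x] falls in no gap
     [[N n, N n.+1)]; starting above [N 0], it would exceed every [N n]. *)
  have Nx n : (N n <= f x)%N.
    elim: n => // n IHn; rewrite leqNgt; apply/negP => xN.
    have [_ KA avoid] := qAP n.
    apply: (avoid x); first by rewrite IHn.
    by apply: (Ix (qA n).2); apply: Kmono KA; apply: rub; exists n.
  by have := leq_trans (geN _) (Nx (f x).+1); rewrite ltnn.
apply: finite_preimage (finite_II _) => x y _ _.
by apply: finj; rewrite inE.
Qed.

Theorem proposition4p1 (d : Order.disp_t) (P : POrderedTopological.type d)
  (P_directed : directed P)
  (P_tychonoff : tychonoff_space P)
  (P_second_countable : @second_countable P)
  (P_seq : convergent_seqs_bounded P)
  (X : Type) (X_countable : countable [set: X])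
  (F : set (power_space X)) (F_free : @free_filter X F)
  (K : P -> set (power_space X))
  (K_sub : forall p : P, K p `<=` F)
  (K_compact : forall p : P, compact (K p : set (subspace F)))
  (K_cover : F = \bigcup_p K p)
  (K_mono : forall p q : P, (p <= q)%O -> K p `<=` K q)
  (K_inf : forall p : P, infinite_set (\bigcap_(A in K p) (A : set X))) :
  meager F.
Proof.
case: P_second_countable => B Bcount Bbasis.
(* The good basic sets: countably many, and they cover [P] by the local statement at each point. *)
pose D := B `&` [set U | nowhere_dense (\bigcup_(q in U) K q)].
have -> : F = \bigcup_(U in D) \bigcup_(q in U) K q.
  rewrite K_cover; apply/seteqP; split => [A [p _ KpA]|A [U _ [q _ KqA]]].
    have [U [BU Up] Und] :=
      @nowhere_dense_basic_union _ _ _ _ _ p Bcount Bbasis P_seq X_countable K_mono K_inf.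
    by exists U => //; exists p.
  by exists q.
apply: meager_countable_bigcup => [|U []//].
by apply: sub_countable Bcount; apply: subset_card_le => U [].
Qed.
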